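(* Let $\Bbbk$ be a field of characteristic $0$, let $N\geq1$ be an integer, let $\nu_1,\ldots,\nu_N\in\Bbbk$ be constants, and set $\nu=\sum_{i=1}^N\nu_i$. Then $$W^{0,1,\ldots,N-1}(x^{\nu_1},\ldots,x^{\nu_N})=\prod_{1\leq i<j\leq N}(\nu_j-\nu_i)\cdot x^{\nu-N(N-1)/2}.$$ That is, the Wronskian determinant of the monomials is a monomial itself and its coefficient is the Vandermonde determinant.
   Context: The monomials $x^\alpha$, $\alpha\in\Bbbk$, are formal powers in the commutative $\Bbbk$-algebra of linear combinations $\sum_\alpha c_\alpha x^\alpha$ ($c_\alpha\in\Bbbk$), with $x^\alpha\cdot x^\beta=x^{\alpha+\beta}$, $x^0=1$, and derivation $\partial=d/dx$ given by $\partial x^\alpha=\alpha x^{\alpha-1}$. The Wronskian determinant is $W^{0,1,\dots,N-1}(a_1,\dots,a_N)=\det\|\partial^{i-1}a_j\|_{1\leq i,j\leq N}$. *)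

(* Defs.v *)
From HB Require Import structures.
From mathcomp Require Import all_boot all_algebra finmap monalg.

Set Implicit Arguments.
Unset Strict Implicit.
Unset Printing Implicit Defensive.

Import GRing.Theory.
Local Open Scope fset_scope.
Local Open Scope ring_scope.

(* The group algebra over k of the additive group of k: finitely supported
   families of coefficients indexed by exponents in k.  It is built on the
   module {malg k[k]}; the product supplied by monalg is not available, because
   it needs a monomType of exponents, in which only the unit is invertible. *)
Definition fpow (k : fieldType) := {malg k[k]}.

HB.instance Definition _ (k : fieldType) :=
  GRing.Lmodule.copy (fpow k) {malg k[k]}.

Definition xpow (k : fieldType) (a : k) : fpow k := mkmalgU a 1.

Section FormalPowers.
Variable k : fieldType.
Implicit Types (f g h : fpow k) (a b c : k).

Definition fpow_mul f g : fpow k :=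
  \sum_(a <- msupp f) \sum_(b <- msupp g) (mcoeff a f * mcoeff b g) *: xpow (a + b).

Lemma fpowP f g : (forall a, mcoeff a f = mcoeff a g) -> f = g.
Proof. by move/malgP. Qed.

Lemma mcoeff_xpow a b : mcoeff b (xpow a) = (a == b)%:R.
Proof. exact: mcoeffU. Qed.

Lemma xpow_neq0 a : xpow a != 0.
Proof.
apply/eqP=> /(congr1 (mcoeff a)); rewrite mcoeff_xpow eqxx mcoeff0.
by move/eqP; rewrite oner_eq0.
Qed.

Lemma fpowEw (d : {fset k}) f : msupp f `<=` d ->
  f = \sum_(a <- d) mcoeff a f *: xpow a.
Proof.
move=> le; rewrite {1}(monalgEw le); apply: eq_bigr => a _.
apply: fpowP => b; rewrite mcoeffU mcoeffZ mcoeff_xpow.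
by rewrite mulr_natr.
Qed.

Lemma fpowE f : f = \sum_(a <- msupp f) mcoeff a f *: xpow a.
Proof. exact: fpowEw. Qed.

Lemma sum_msuppw (V : lmodType k) (F : k -> V) (d : {fset k}) f :
  msupp f `<=` d ->
  \sum_(a <- msupp f) mcoeff a f *: F a = \sum_(a <- d) mcoeff a f *: F a.
Proof.
move=> le; apply: (big_fset_incl _ le) => a _ /mcoeff_outdom ->.
by rewrite scale0r.
Qed.

Lemma sum_msupp_linear (V : lmodType k) (F : k -> V) :
  linear (fun f : fpow k => \sum_(a <- msupp f) mcoeff a f *: F a).
Proof.
move=> c f g /=; set d := msupp f `|` msupp g.
have le : msupp (c *: f + g) `<=` d.
  apply: (fsubset_trans (msuppD_le _ _)).
  exact: fsetSU (msuppZ_le _ _).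
rewrite (sum_msuppw F le) (sum_msuppw F (fsubsetUl _ (msupp g))).
rewrite (sum_msuppw F (fsubsetUr (msupp f) _)) scaler_sumr -big_split /=.
by apply: eq_bigr => a _; rewrite mcoeffD mcoeffZ scalerDl scalerA.
Qed.

Lemma sum_msupp_xpow (V : lmodType k) (F : k -> V) b :
  \sum_(a <- msupp (xpow b)) mcoeff a (xpow b) *: F a = F b.
Proof.
by rewrite /xpow msuppU oner_eq0 big_seq_fset1 mcoeffUU scale1r.
Qed.

(* A linear map is determined by its values on the monomials. *)
Lemma fpow_lin_ext (V : lmodType k) (u v : fpow k -> V) :
  linear u -> linear v -> (forall a, u (xpow a) = v (xpow a)) -> u =1 v.
Proof.
move=> lu lv E f.
pose u' : {linear fpow k -> V} :=
  HB.pack u (GRing.isLinear.Build k (fpow k) V *:%R u lu).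
pose v' : {linear fpow k -> V} :=
  HB.pack v (GRing.isLinear.Build k (fpow k) V *:%R v lv).
rewrite (fpowE f) -[u]/(u' : _ -> _) -[v]/(v' : _ -> _) !linear_sum.
by apply: eq_bigr => a _; rewrite !linearZ /= E.
Qed.

Lemma fpow_mull f g :
  fpow_mul f g = \sum_(a <- msupp f) mcoeff a f *:
                   \sum_(b <- msupp g) mcoeff b g *: xpow (a + b).
Proof.
apply: eq_bigr => a _; rewrite scaler_sumr.
by apply: eq_bigr => b _; rewrite scalerA.
Qed.

Lemma fpow_mulC : commutative fpow_mul.
Proof.
move=> f g; rewrite /fpow_mul exchange_big; apply: eq_bigr => b _.
by apply: eq_bigr => a _; rewrite mulrC addrC.
Qed.

Lemma fpow_mul_linearl g : linear (fpow_mul^~ g).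
Proof. by move=> c f f'; rewrite !fpow_mull; exact: sum_msupp_linear. Qed.

Lemma fpow_mul_linearr f : linear (fpow_mul f).
Proof. by move=> c g g'; rewrite !(fpow_mulC f) fpow_mul_linearl. Qed.

Lemma fpow_mul_xpow a b : fpow_mul (xpow a) (xpow b) = xpow (a + b).
Proof. by rewrite fpow_mull !sum_msupp_xpow. Qed.

Lemma fpow_mulA : associative fpow_mul.
Proof.
move=> f g h.
apply: (fpow_lin_ext (u := fun f => fpow_mul f (fpow_mul g h))
  (v := fun f => fpow_mul (fpow_mul f g) h)) => [|c f1 f2|a] /=.
- exact: fpow_mul_linearl.
- by rewrite !fpow_mul_linearl.
apply: (fpow_lin_ext (u := fun g => fpow_mul (xpow a) (fpow_mul g h))
  (v := fun g => fpow_mul (fpow_mul (xpow a) g) h)) => [c g1 g2|c g1 g2|b] /=.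
- by rewrite fpow_mul_linearl fpow_mul_linearr.
- by rewrite fpow_mul_linearr fpow_mul_linearl.
apply: (fpow_lin_ext (u := fun h => fpow_mul (xpow a) (fpow_mul (xpow b) h))
  (v := fun h => fpow_mul (fpow_mul (xpow a) (xpow b)) h)) => [c1 g1 g2||c] /=.
- by rewrite !fpow_mul_linearr.
- exact: fpow_mul_linearr.
by rewrite !fpow_mul_xpow addrA.
Qed.

Lemma fpow_mul1 : left_id (xpow 0) fpow_mul.
Proof.
apply: (fpow_lin_ext (v := id)) => [||a] //; first exact: fpow_mul_linearr.
by rewrite fpow_mul_xpow add0r.
Qed.

Lemma fpow_mulDl : left_distributive fpow_mul +%R.
Proof.
by move=> f g h; have := fpow_mul_linearl h 1 f g; rewrite /= !scale1r.
Qed.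

HB.instance Definition _ := GRing.Zmodule_isComNzRing.Build (fpow k)
  fpow_mulA fpow_mulC fpow_mul1 fpow_mulDl (xpow_neq0 0).

Lemma fpow_scaleAl c f g : c *: (f * g) = (c *: f) * g.
Proof.
have /= := fpow_mul_linearl g c f 0.
by rewrite -[fpow_mul 0 g]/(0 * g) mul0r !addr0.
Qed.

HB.instance Definition _ :=
  GRing.Lmodule_isLalgebra.Build k (fpow k) fpow_scaleAl.
HB.instance Definition _ := GRing.Lalgebra_isComAlgebra.Build k (fpow k).

Lemma xpow0 : xpow 0 = 1 :> fpow k.
Proof. by []. Qed.

Lemma xpowD a b : xpow (a + b) = xpow a * xpow b.
Proof. by rewrite -fpow_mul_xpow. Qed.

Definition fpow_deriv f : fpow k :=
  \sum_(a <- msupp f) mcoeff a f *: (a *: xpow (a - 1)).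

Lemma fpow_deriv_linear : linear fpow_deriv.
Proof. exact: sum_msupp_linear. Qed.

HB.instance Definition _ :=
  GRing.isLinear.Build k (fpow k) (fpow k) *:%R fpow_deriv fpow_deriv_linear.

Lemma fpow_deriv_xpow a : fpow_deriv (xpow a) = a *: xpow (a - 1).
Proof. exact: sum_msupp_xpow. Qed.

Lemma fpow_derivM f g :
  fpow_deriv (f * g) = fpow_deriv f * g + f * fpow_deriv g.
Proof.
apply: (fpow_lin_ext (u := fun f => fpow_deriv (f * g))
  (v := fun f => fpow_deriv f * g + f * fpow_deriv g))
  => [c f1 f2|c f1 f2|a] /=.
- by rewrite mulrDl -scalerAl linearP.
- by rewrite linearP !mulrDl -!scalerAl scalerDr addrACA.
apply: (fpow_lin_ext (u := fun g => fpow_deriv (xpow a * g))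
  (v := fun g => fpow_deriv (xpow a) * g + xpow a * fpow_deriv g))
  => [c f1 f2|c f1 f2|b] /=.
- by rewrite mulrDr -scalerAr linearP.
- by rewrite linearP !mulrDr -!scalerAr scalerDr addrACA.
rewrite -xpowD !fpow_deriv_xpow -scalerAl -scalerAr -!xpowD.
by rewrite [a - 1 + b]addrAC [a + (b - 1)]addrA -scalerDl.
Qed.

End FormalPowers.

Definition wronskian (A : comNzRingType) (d : A -> A) (N : nat)
    (f : 'I_N -> A) : A :=
  \det (\matrix_(i < N, j < N) iter i d (f j)).

(* Main.v *)
Require Import Defs.
From mathcomp Require Import all_boot all_algebra.

Set Implicit Arguments.
Unset Strict Implicit.
Unset Printing Implicit Defensive.

Import GRing.Theory.
Local Open Scope ring_scope.

(** Differentiating a monomial [i] times gives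
    [x^a |-> a (a - 1) ... (a - i + 1) x^(a - i)], so the entry in row [i] and
    column [j] of the Wronskian matrix is [x^(- i) * p_i(nu_j) * x^(nu_j)],
    where [p_i] is the falling factorial polynomial ([falling_poly]).  The
    factors [x^(- i)] depend only on the row and the factors [x^(nu_j)] only on
    the column.  Since monomials are invertible, they all come out of the
    determinant, and they collect into the single power of [x] on the right.

    There remains the scalar determinant of the matrix [p_i(nu_j)].  As [p_i] is
    monic of degree [i], this matrix is the Vandermonde matrix of the [nu_j]
    multiplied by a unitriangular matrix of coefficients, hence it has the same
    determinant ([det_monic_eval]).  The exponent involves the sum
    of [0, 1, ..., N - 1], which equals [N (N - 1) / 2] in [k] because 2 is
    nonzero there. *)

(** Row operations turn the powers [1, X, X^2, ...] into any other sequence of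
    monic polynomials of degrees [0, 1, 2, ...]: the change of basis is lower
    triangular with the leading coefficients, all equal to 1, on its
    diagonal. *)
Lemma det_monic_eval (R : comNzRingType) (N : nat) (p : nat -> {poly R})
    (a : 'rV[R]_N) :
    (forall i, p i \is monic) -> (forall i, size (p i) = i.+1) ->
  \det (\matrix_(i < N, j < N) (p i).[a 0 j]) = \det (Vandermonde N a).
Proof.
move=> p_monic size_p; pose L : 'M[R]_N := \matrix_(i, l) (p i)`_l.
have -> : \matrix_(i < N, j < N) (p i).[a 0 j] = L *m Vandermonde N a.
  apply/matrixP=> i j; rewrite !mxE (@horner_coef_wide _ N) ?size_p //.
  by apply: eq_bigr => l _; rewrite !mxE.
rewrite det_mulmx det_trig; last first.
  by apply/is_trig_mxP=> i l lt_il; rewrite mxE nth_default ?size_p.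
rewrite big1 ?mul1r // => i _.
by have /monicP := p_monic i; rewrite lead_coefE size_p mxE.
Qed.

Definition falling_poly (R : comNzRingType) (i : nat) : {poly R} :=
  \prod_(l < i) ('X - l%:R%:P).

Lemma falling_polyS (R : comNzRingType) (i : nat) :
  falling_poly R i.+1 = falling_poly R i * ('X - i%:R%:P).
Proof. exact: big_ord_recr. Qed.

Lemma falling_poly_monic (R : comNzRingType) (i : nat) :
  falling_poly R i \is monic.
Proof. by apply: monic_prod => l _; exact: monicXsubC. Qed.

Lemma size_falling_poly (R : comNzRingType) (i : nat) :
  size (falling_poly R i) = i.+1.
Proof. by rewrite size_prod_XsubC /index_enum -enumT size_enum_ord. Qed.

Lemma iter_deriv_xpow (k : fieldType) (i : nat) (a : k) :
  iter i (@fpow_deriv k) (xpow a) = (falling_poly k i).[a] *: xpow (a - i%:R).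
Proof.
elim: i => [|i IHi].
  by rewrite /falling_poly big_ord0 hornerC scale1r subr0.
rewrite iterS IHi linearZ /= fpow_deriv_xpow scalerA falling_polyS hornerM.
by rewrite hornerXsubC -addrA -opprD natr1.
Qed.

Lemma prod_xpow (k : fieldType) (I : finType) (f : I -> k) :
  \prod_i xpow (f i) = xpow (\sum_i f i).
Proof. by symmetry; apply: (big_morph (@xpow k)) => // a b; exact: xpowD. Qed.

Lemma det_scale_rows_cols (R : comNzRingType) (N : nat) (r c : 'I_N -> R)
    (M : 'M[R]_N) :
  \det (\matrix_(i, j) (r i * M i j * c j)) =
    (\prod_i r i) * \det M * (\prod_j c j).
Proof.
have -> : \matrix_(i, j) (r i * M i j * c j) =
    diag_mx (\row_i r i) *m M *m diag_mx (\row_j c j).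
  by apply/matrixP=> i j; rewrite mul_mx_diag mul_diag_mx !mxE.
rewrite !det_mulmx !det_diag.
by congr (_ * _ * _); apply: eq_bigr => i _; rewrite mxE.
Qed.

(** The shift of the exponent is kept as a sum, one term for each row, so that
    the formula holds in every characteristic; its closed form requires a
    division by 2. *)
Lemma wronskian_xpow (k : fieldType) (N : nat) (nu : 'I_N -> k) :
  wronskian (@fpow_deriv k) (fun j : 'I_N => xpow (nu j)) =
    \det (Vandermonde N (\row_(j < N) nu j))
      *: xpow (\sum_(i < N) nu i - \sum_(i < N) (i : nat)%:R).
Proof.
rewrite -(det_monic_eval _ (@falling_poly_monic k) (@size_falling_poly k)).
set M := (X in _ = \det X *: _).
rewrite /wronskian.
have -> : \matrix_(i < N, j < N) iter i (@fpow_deriv k) (xpow (nu j)) =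
    \matrix_(i, j) (xpow (- (i : nat)%:R) * map_mx (in_alg (fpow k)) M i j
                    * xpow (nu j)).
  apply/matrixP=> i j; rewrite !mxE iter_deriv_xpow /= -scalerAr mulr1.
  by rewrite -scalerAl -xpowD addrC.
rewrite det_scale_rows_cols det_map_mx !prod_xpow /= -scalerAr mulr1.
by rewrite -scalerAl -xpowD sumrN addrC.
Qed.

Lemma sum_ord_half (k : fieldType) (N : nat) : 2%:R != 0 :> k ->
  \sum_(i < N) (i : nat)%:R = (N * (N - 1))%:R / 2%:R :> k.
Proof.
move=> nz2; apply: (canRL (mulfK nz2)).
rewrite -natr_sum -natrM -(big_mkord xpredT id) bin2_sum.
by rewrite -[2%N]/(2`!) bin_ffact ffactnS ffactn1 subn1.
Qed.

Theorem theorem13 (k : fieldType) (hchar : [pchar k] =i pred0)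
    (N : nat) (hN : (1 <= N)%N) (nu : 'I_N -> k) :
  wronskian (@fpow_deriv k) (fun j : 'I_N => xpow (nu j)) =
    (\prod_(i < N) \prod_(j < N | (i < j)%N) (nu j - nu i))
      *: xpow (\sum_(i < N) nu i - (N * (N - 1))%:R / 2%:R)
  /\ \prod_(i < N) \prod_(j < N | (i < j)%N) (nu j - nu i) =
    \det (Vandermonde N (\row_(j < N) nu j)).
Proof.
have detV : \prod_(i < N) \prod_(j < N | (i < j)%N) (nu j - nu i) =
    \det (Vandermonde N (\row_(j < N) nu j)).
  rewrite det_Vandermonde; apply: eq_bigr => i _.
  by apply: eq_bigr => j _; rewrite !mxE.
split=> //; rewrite detV wronskian_xpow sum_ord_half //.
by have /pcharf0P -> := hchar.
Qed.
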